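(* Let $A$ be an open convex subset of an infinite-dimensional real Banach space $X$. Let $A_1,\ldots,A_n$ be nonempty convex sets in $X$ such that, for each $i=1,\ldots,n$ and each $x\in\partial A_i$, there exists a hyperplane $\Gamma$ supporting $\overline{A_i}$ at $x$ such that $\Gamma\cap\overline{A_i}=\{x\}$. Define $D=A\setminus(A_1\cup\dots\cup A_n)$. Then $$D\subset\operatorname{int}\bigl(\overline{\mathrm{conv}}(D)\bigr).$$
   Context: All topological notions (interior $\operatorname{int}$, boundary $\partial$, closure) refer to the norm topology of $X$. $\overline{\mathrm{conv}}(D)$ is the closed convex hull of $D$ (empty if $D$ is empty). A hyperplane $\Gamma$ supports a set $C$ at a point $x\in C$ if $\Gamma$ is a closed affine hyperplane containing $x$ and $C$ lies in one of the two closed half-spaces determined by $\Gamma$. *)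

(* Defs.v *)
From HB Require Import structures.
From mathcomp Require Import all_boot all_order all_algebra.
From mathcomp Require Import all_classical all_reals topology normedtype convex.

Set Implicit Arguments.
Unset Strict Implicit.
Unset Printing Implicit Defensive.

Import Order.TTheory GRing.Theory Num.Theory.
Import numFieldNormedType.Exports.

Local Open Scope classical_set_scope.
Local Open Scope ring_scope.

Definition finite_dimensional (R : realType) (X : lmodType R) : Prop :=
  exists (n : nat) (e : 'I_n -> X),
    forall x : X, exists a : 'I_n -> R, x = \sum_(i < n) a i *: e i.

Definition infinite_dimensional (R : realType) (X : lmodType R) : Prop :=
  ~ finite_dimensional X.

Definition boundary (T : topologicalType) (A : set T) : set T :=
  closure A `\` interior A.

Definition closed_convex_hull (R : realType) (X : normedModType R)
    (D : set X) : set X :=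
  smallest [set C : set X | closed C /\ convex_set C] D.

(* The level set [set y | f y = c] is a closed affine hyperplane exactly
   because f is a continuous linear functional that is not identically zero;
   the two closed half-spaces it determines are f <= c and f >= c. *)
Definition supports_at (R : realType) (X : normedModType R)
    (Gamma C : set X) (x : X) : Prop :=
  exists (f : {linear X -> R^o}) (c : R),
    [/\ continuous f /\ (exists v : X, f v != 0),
        Gamma = [set y | f y = c],
        C x,
        Gamma x
      & C `<=` [set y | f y <= c] \/ C `<=` [set y | f y >= c]].

(* Main.v *)
Require Import Defs.
From HB Require Import structures.
From mathcomp Require Import all_boot all_order all_algebra.
From mathcomp Require Import all_classical all_reals topology normedtype convex.
From mathcomp Require Import interval_inference.

Set Implicit Arguments.
Unset Strict Implicit.
Unset Printing Implicit Defensive.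

Import Order.TTheory GRing.Theory Num.Theory.
Import numFieldNormedType.Exports.

Local Open Scope classical_set_scope.
Local Open Scope ring_scope.

(** Let [x] be in [D].  Whenever [x] lies in the closure of [A_ i], choose a
    functional exposing it.  As [X] is infinite-dimensional, these finitely many
    functionals have a common zero [y <> 0], and for small [t <> 0] the points
    [x + t y] and [x - t y] avoid all the closures, hence lie in the interior of
    [D].  Their midpoint [x] is then interior to the convex hull of [D]. *)

(** Finitely many functionals have a common kernel of finite codimension: the span of [e]
    complements it. By induction on [s], one vector is added to [e] only if [f] does not already
    vanish on the common kernel of [s]. *)
Lemma finite_codim_kernel (R : realType) (X : lmodType R)
    (s : seq {linear X -> R^o}) :
  exists (m : nat) (e : 'I_m -> X), forall x : X, exists a : 'I_m -> R,
    forall f, f \in s -> f (x - \sum_(i < m) a i *: e i) = 0.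
Proof.
elim: s => [|f s [m [e IH]]]; first by exists 0%N, (fun=> 0) => x; exists (fun=> 0).
have [[v vs fv]|nv] := pselect (exists2 v, (forall g, g \in s -> g v = 0) & f v != 0).
  pose e' (i : 'I_m.+1) := if unlift ord0 i is Some j then e j else v.
  exists m.+1, e' => x; have [a ha] := IH x.
  set w := x - _ in ha.
  (* Subtracting [(f w / f v) *: v] from the remainder [w] kills [f], and keeps the zeros of [s]
     because [s] vanishes at [v]. *)
  exists (fun i => if unlift ord0 i is Some j then a j else f w / f v) => g.
  rewrite big_ord_recl /e' unlift_none.
  under eq_bigr do rewrite liftK.
  rewrite [_ + \sum_(_ < _) _]addrC opprD addrA -/w linearB linearZ /=.
  rewrite inE => /predU1P[->|gs]; last by rewrite ha// vs// scaler0 subr0.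
  by rewrite /GRing.scale /= divfK// subrr.
exists m, e => x; have [a ha] := IH x; exists a => g.
rewrite inE => /predU1P[->|]; last exact: ha.
(* A remainder with nonzero image under [f] would itself be such a [v]. *)
by apply: contra_notP nv => /eqP fw; exists (x - \sum_(i < m) a i *: e i).
Qed.

Lemma common_zero (R : realType) (X : lmodType R) (n : nat)
    (f : 'I_n -> {linear X -> R^o}) :
  infinite_dimensional X -> exists2 y : X, y != 0 & forall i, f i y = 0.
Proof.
apply: contra_notP => noy.
have [m [e me]] := finite_codim_kernel (codom f).
exists m, e => x; have [a ha] := me x; exists a.
apply: contra_notP noy => /eqP; rewrite -subr_eq0 => xe.
by exists (x - \sum_(i < m) a i *: e i) => // i; apply: ha; exact: codom_f.
Qed.

Lemma convex_midpoint (R : realType) (X : lmodType R) (C : set X) (z u : X) :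
  convex_set C -> C (z + u) -> C (z - u) -> C z.
Proof.
move=> cC Cp Cm.
have h0 : 0 <= 2^-1 :> R by rewrite invr_ge0 ler0n.
have h1 : 2^-1 <= 1 :> R by rewrite invf_le1 ?ler1n ?ltr0n.
have /set_mem := cC _ _ (Itv01 h0 h1) (mem_set Cp) (mem_set Cm).
rewrite /conv /= /unstable.onem.
have -> : 1 - 2^-1 = 2^-1 :> R by rewrite [X in X - _](splitr 1) mul1r addrK.
rewrite -scalerDr addrACA subrr addr0 -mulr2n -(scaler_nat 2 z) scalerA.
by rewrite mulVf ?pnatr_eq0// scale1r.
Qed.

(** Translation by [u] and by [- u] sends every [z] near [x] into [D], and [z] is the midpoint of
    its two images. *)
Lemma midpoint_interior (R : realType) (X : normedModType R) (D : set X)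
    (x u : X) :
  interior D (x + u) -> interior D (x - u) -> interior (closed_convex_hull D) x.
Proof.
rewrite /interior/= => Dp Dm.
have Hp : \forall z \near x, D (z + u).
  have : z + u @[z --> x] --> x + u by apply: cvgD; [exact: cvg_id|exact: cvg_cst].
  exact.
have Hm : \forall z \near x, D (z - u).
  have : z - u @[z --> x] --> x - u by apply: cvgB; [exact: cvg_id|exact: cvg_cst].
  exact.
near=> z => C [[_ cC] DC].
apply: (@convex_midpoint _ _ C z u) => //; apply: DC.
  by near: z.
by near: z.
Unshelve. all: by end_near. Qed.

Theorem lemma3p5 (R : realType) (X : completeNormedModType R)
    (A : set X) (n : nat) (A_ : 'I_n -> set X) :
  infinite_dimensional X ->
  open A -> convex_set A ->
  (forall i : 'I_n, A_ i !=set0) ->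
  (forall i : 'I_n, convex_set (A_ i)) ->
  (forall (i : 'I_n) (x : X), boundary (A_ i) x ->
     exists Gamma : set X,
       supports_at Gamma (closure (A_ i)) x /\
       Gamma `&` closure (A_ i) = [set x]) ->
  let D := A `\` \bigcup_i A_ i in
  D `<=` interior (closed_convex_hull D).
Proof.
move=> Xinf oA _ _ _ exposed D x [Ax nAx].
have expose i : exists f : {linear X -> R^o}, forall y, y != 0 -> f y = 0 ->
    closure (A_ i) x -> ~ closure (A_ i) (x + y).
  (* Off the closure the requirement is vacuous, so the zero functional serves as a default. *)
  have [clx|nclx] := pselect (closure (A_ i) x); last by exists \0.
  have [|G [[f [c [_ GE _ Gx _]]] Gcl]] := exposed i x.
    by split=> // /interior_subset Aix; apply: nAx; exists i.
  exists f => y y0 fy _ clxy.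
  have : (G `&` closure (A_ i)) (x + y).
    by split=> //; move: Gx; rewrite GE /= linearD fy addr0.
  by rewrite Gcl /= => /eqP; rewrite -subr_eq0 addrAC subrr add0r (negbTE y0).
have [f fP] := choice expose.
have [y y0 fy] := common_zero f Xinf.
have escape (v : X) : v != 0 -> (forall i, f i v = 0) ->
    \forall t \near (0 : R)^', interior D (x + t *: v).
  move=> v0 fv.
  have cvgx : (fun t : R => x + t *: v) @ 0^' --> x.
    rewrite -[X in _ --> X]addr0 -(scale0r v); apply: cvgD; first exact: cvg_cst.
    by apply: cvgZr_tmp; exact: nbhs_dnbhs.
  have avoid : \forall t \near (0 : R)^', forall i, ~ closure (A_ i) (x + t *: v).
    apply: filter_forall => i.
    (* If [x] is in the closure, every [t != 0] works, since [t *: v] stays in the kernel of [f i];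
       otherwise [t] has to be small. *)
    have [clx|nclx] := pselect (closure (A_ i) x).
      near=> t; apply: (fP i) => //; last by rewrite linearZ /= fv scaler0.
      by rewrite scaler_eq0 negb_or v0 andbT; near: t; exact: nbhs_dnbhs_neq.
    apply: (cvgx (~` closure (A_ i))); apply: open_nbhs_nbhs; split => //.
    exact/closed_openC/closed_closure.
  near=> t.
  have: \forall z \near x + t *: v, A z.
    apply: open_nbhs_nbhs; split => //; near: t; apply: (cvgx A).
    exact: open_nbhs_nbhs.
  (* Avoiding closures, not just the sets, is an open condition, so it extends to a
     neighbourhood. *)
  have: \forall z \near x + t *: v, forall i, ~ closure (A_ i) z.
    apply: filter_forall => i; apply: open_nbhs_nbhs; split.
      exact/closed_openC/closed_closure.
    by move: i; near: t.
  apply: filterS2 => z nz Az; split=> // -[i _ /subset_closure]; exact: nz.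
have [t [tp tm]] : exists t : R,
    interior D (x + t *: y) /\ interior D (x + t *: (- y)).
  (* The punctured neighbourhoods of 0 form a proper filter, so one [t] serves both directions. *)
  apply: (@filter_ex _ (0 : R)^'); apply: filterI; apply: escape => //.
  - by rewrite oppr_eq0.
  - by move=> i; rewrite linearN fy oppr0.
by apply: midpoint_interior tp _; rewrite -scalerN.
Unshelve. all: by end_near. Qed.
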